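(* There are infinitely many integers $n\ge 0$ such that $a(n)$ is even, and there are infinitely many integers $n\ge 0$ such that $a(n)$ is odd.
   Context: Let $(q;q)_\infty=\prod_{n=1}^\infty(1-q^n)$ and $(q^2;q^2)_\infty=\prod_{n=1}^\infty(1-q^{2n})$. The number of cubic partitions $a(n)$ is defined for $n\ge 0$ by the generating function $\sum_{n=0}^\infty a(n)q^n=\frac{1}{(q;q)_\infty(q^2;q^2)_\infty}$. *)

(* Defs.v *)
From mathcomp Require Import all_boot all_order all_algebra.
From mathcomp Require Import boolp classical_sets cardinality.

Set Implicit Arguments.
Unset Strict Implicit.
Unset Printing Implicit Defensive.

Import GRing.Theory.
Local Open Scope ring_scope.

(* A formal power series in q with integer coefficients is represented by its
   coefficient sequence. *)
Definition fps := nat -> int.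

Definition fps_one : fps := fun n => (n == 0%N)%:R.

Definition fps_mul (f g : fps) : fps :=
  fun n => \sum_(i < n.+1) f i * g (n - i)%N.

Fixpoint fps_inv_prefix (f : fps) (n : nat) : seq int :=
  if n is m.+1 then
    let s := fps_inv_prefix f m in
    rcons s ((f 0%N)^-1 * ((m == 0%N)%:R - \sum_(i < m) f (m - i)%N * s`_i))
  else [::].

(* The inverse series, computed by solving f * g = 1 for one coefficient after
   the other; meaningful when f 0 is a unit, see fps_mul_inv. *)
Definition fps_inv (f : fps) : fps := fun n => (fps_inv_prefix f n.+1)`_n.

(* (q^d; q^d)_oo = \prod_(k >= 1) (1 - q^(d k)) for d > 0. The coefficient of
   q^n is read off the n-th partial product: by qpoch_limit it is the common
   value of that coefficient in all later partial products. *)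
Definition qpoch (d : nat) : fps :=
  fun n => (\prod_(1 <= k < n.+1) (1 - 'X^(d * k)) : {poly int})`_n.

Definition cubic_partitions : fps := fps_inv (fps_mul (qpoch 1) (qpoch 2)).

Lemma qpoch_limit (d n m : nat) : (0 < d)%N -> (n <= m)%N ->
  (\prod_(1 <= k < m.+1) (1 - 'X^(d * k)) : {poly int})`_n = qpoch d n.
Proof.
move=> d0 /subnK <-; elim: (m - n)%N => // j IH.
rewrite addSn big_nat_recr //= mulrBr mulr1 coefB coefMXn IH.
suff -> : (n < d * (j + n).+1)%N by rewrite subr0.
by apply: leq_trans (leq_pmull _ d0); rewrite ltnS leq_addl.
Qed.

Lemma qpoch0 (d : nat) : qpoch d 0 = 1.
Proof. by rewrite /qpoch big_geq // coef1. Qed.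

Lemma size_fps_inv_prefix f n : size (fps_inv_prefix f n) = n.
Proof. by elim: n => //= n IH; rewrite size_rcons IH. Qed.

Lemma nth_fps_inv_prefix f n i : (i < n)%N ->
  (fps_inv_prefix f n)`_i = fps_inv f i.
Proof.
elim: n => // n IH; rewrite ltnS leq_eqVlt => /predU1P[-> //|lt_in].
by rewrite [LHS]/= nth_rcons size_fps_inv_prefix lt_in IH.
Qed.

Lemma fps_mul_inv (f : fps) (n : nat) : f 0%N \is a GRing.unit ->
  fps_mul f (fps_inv f) n = fps_one n.
Proof.
move=> f0; rewrite /fps_mul (reindex_inj rev_ord_inj) /= big_ord_recr /=.
rewrite subSS subnn subn0.
rewrite [fps_inv f n]/fps_inv /= nth_rcons size_fps_inv_prefix ltnn eqxx.
rewrite mulrA divrr // mul1r addrC.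
rewrite [X in _ + X](_ : _ = \sum_(i < n) f (n - i)%N * (fps_inv_prefix f n)`_i).
  by rewrite subrK.
apply: eq_bigr => i _; rewrite nth_fps_inv_prefix // subSS subKn //.
exact: ltnW.
Qed.

Lemma cubic_partitions_gf (n : nat) :
  fps_mul (fps_mul (qpoch 1) (qpoch 2)) cubic_partitions n = fps_one n.
Proof.
by apply: fps_mul_inv; rewrite /fps_mul big_ord1 !qpoch0 mulr1 unitr1.
Qed.

(* Main.v *)
Require Import Defs.
From mathcomp Require Import all_boot all_order all_algebra.
From mathcomp Require Import boolp classical_sets cardinality.
From mathcomp Require Import zify ring.

Import GRing.Theory.
Local Open Scope ring_scope.

(* Modulo 2, (q;q)^2 = (q^2;q^2), and Gauss's identity
   psi(q) := \sum_j q^(j(j+1)/2) = (q^2;q^2)^2 / (q;q) becomes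
   psi = (q;q) (q^2;q^2). Hence psi is the inverse mod 2 of the generating
   function of a(n): writing T_j = j(j+1)/2, the sum over all j with T_j <= i
   of a(i - T_j) is even for i > 0. If a(n) had constant parity c for all large
   n, then taking i = T_(k+1) - 1 with k large shows that (k+1) c is even, and
   i = T_(k+1), which has the additional summand a(0) = 1, that (k+1) c + 1 is
   even. *)

(* Shanks's finite form of Gauss's identity, cleared of denominators. On the
   right only the term s = 0 survives modulo q^(2n+1). *)
Lemma triangular_sum (R : comNzRingType) (q : R) (n : nat) :
  \prod_(k < n) (1 - q ^+ k.*2.+1) * \sum_(j < n.*2) q ^+ 'C(j.+1, 2) =
  \sum_(s < n) \prod_(k < s) (1 - q ^+ k.*2.+1) *
    \prod_(s <= k < n) (1 - q ^+ k.+1.*2) * q ^+ (s * n.*2.+1).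
Proof.
pose D s := \prod_(k < s) (1 - q ^+ k.*2.+1).
have DS s : D s.+1 = D s * (1 - q ^+ s.*2.+1) by rewrite /D big_ord_recr.
elim: n => [|n IHn]; first by rewrite !big_ord0 mulr0.
pose N s := \prod_(s <= k < n) (1 - q ^+ k.+1.*2).
(* G telescopes the difference of the right-hand sides for n + 1 and n. *)
pose G s := D s * (1 - q ^+ s.*2) * N s * q ^+ (s * n.*2.+1).
have step s : (s < n)%N ->
  D s * \prod_(s <= k < n.+1) (1 - q ^+ k.+1.*2) * q ^+ (s * n.+1.*2.+1) =
  (1 - q ^+ n.*2.+1) * (D s * N s * q ^+ (s * n.*2.+1)) + (G s.+1 - G s).
  move=> lt_sn; rewrite big_nat_recr ?(ltnW lt_sn) //= -/(N s) /G DS.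
  have -> : N s = (1 - q ^+ s.+1.*2) * N s.+1 by rewrite /N big_ltn.
  have -> : (s * n.+1.*2.+1 = s * n.*2.+1 + s.*2)%N by lia.
  have -> : (s.+1 * n.*2.+1 = s * n.*2.+1 + n.*2.+1)%N by lia.
  have -> : n.+1.*2 = (n.*2.+1).+1 by [].
  rewrite (exprS q n.*2.+1) (exprS q s.*2) !exprD; ring.
rewrite [RHS]big_ord_recr /= -/(D n) big_nat1.
rewrite (eq_bigr (fun s : 'I_n => (1 - q ^+ n.*2.+1) *
  (D s * N s * q ^+ (s * n.*2.+1)) + (G s.+1 - G s))); last first.
  by move=> s _; apply: step.
rewrite big_split /= -big_distrr /= -IHn -/(D n).
rewrite -(big_mkord xpredT (fun s => G s.+1 - G s)) telescope_sumr //.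
have -> : G 0%N = 0 by rewrite /G expr0 subrr mulr0 !mul0r.
have -> : G n = D n * (1 - q ^+ n.*2) * q ^+ (n * n.*2.+1).
  by rewrite /G /N big_geq // mulr1.
(* With D n and q^(n(2n+1)) factored out, the new left summands j = 2n, 2n+1 match [G n] plus the
   term s = n: (1 - q^(2n+1)) (1 + q^(2n+1)) = (1 - q^(2n)) + q^(2n) (1 - q^(2n+2)). *)
rewrite -/(D n.+1) DS doubleS !big_ord_recr /=.
have -> : 'C(n.*2.+1, 2) = (n * n.*2.+1)%N by rewrite bin2 -mul2n; nia.
have -> : 'C(n.*2.+2, 2) = (n * n.*2.+1 + n.*2.+1)%N.
  by rewrite binS bin1 bin2 -!mul2n; nia.
have -> : (n * (n.*2).+3 = n * n.*2.+1 + n.*2)%N by lia.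
rewrite exprD (exprD _ _ n.*2) !(exprS q n.*2.+1) (exprS q n.*2); ring.
Qed.

Section Pochhammer.
Variable R : comNzRingType.
Implicit Types d m n j : nat.

Definition qpochn d m : {poly R} := \prod_(1 <= k < m.+1) (1 - 'X^(d * k)).

Lemma qpochnS d m : qpochn d m.+1 = qpochn d m * (1 - 'X^(d * m.+1)).
Proof. by rewrite /qpochn big_nat_recr. Qed.

Lemma qpochn_double n :
  qpochn 1 n.*2 = \prod_(k < n) (1 - 'X ^+ k.*2.+1) * qpochn 2 n.
Proof.
elim: n => [|n IHn]; first by rewrite big_ord0 mul1r /qpochn !big_geq.
rewrite doubleS 3!qpochnS IHn big_ord_recr /= !mul1n mul2n doubleS; ring.
Qed.

(** Squaring is a ring morphism in characteristic 2, so it acts on each factor separately. *)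
Lemma qpochn_sqr d m : 2 \in [pchar R] -> qpochn d m ^+ 2 = qpochn (2 * d) m.
Proof.
move=> R2; rewrite /qpochn -prodrXl; apply: eq_bigr => k _.
have X2 : 2 \in [pchar {poly R}] by rewrite (rmorph_pchar polyC).
rewrite -(pFrobenius_autE X2) pFrobenius_autB_comm; last exact: mulrC.
by rewrite pFrobenius_aut1 pFrobenius_autE -exprM mulnC mulnA.
Qed.

(** Each further factor is 1 modulo X^(d(m+1)). *)
Lemma qpochn_stable d m j :
  exists u, qpochn d (m + j) = qpochn d m + u * 'X^(d * m.+1).
Proof.
elim: j => [|j [u IHj]]; first by exists 0; rewrite addn0 mul0r addr0.
exists (u - (qpochn d m + u * 'X^(d * m.+1)) * 'X^(d * j)).
rewrite addnS qpochnS IHj.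
have -> : (d * (m + j).+1 = d * j + d * m.+1)%N by lia.
by rewrite exprD; ring.
Qed.

Lemma map_qpochn (S : comNzRingType) (f : {rmorphism S -> R}) d m :
  map_poly f (\prod_(1 <= k < m.+1) (1 - 'X^(d * k))) = qpochn d m.
Proof.
rewrite rmorph_prod; apply: eq_bigr => k _.
by rewrite rmorphB rmorph1 /= map_polyXn.
Qed.

End Pochhammer.

Arguments qpochn {R} d m.

(** Truncation of psi modulo 2; ['C(j.+1, 2)] is T_j. *)
Definition triangular_poly n : {poly 'F_2} := \sum_(j < n) 'X^('C(j.+1, 2)).

Lemma pochhammer_triangular n : (0 < n)%N ->
  'X^(n.*2.+1) %| (triangular_poly n.*2 - qpochn 1 n.*2 * qpochn 2 n.*2).
Proof.
case: n => // n _; set m := n.+1.*2; set psi := triangular_poly _.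
have F2 : 2 \in [pchar 'F_2] by exact: pchar_Fp.
(* The constant term of (q;q)_m is 1, so the difference may be multiplied by (q;q)_m = D N without
   changing divisibility by X^(m+1). *)
have co : coprimep 'X^(m.+1) (qpochn 1 m : {poly 'F_2}).
  rewrite coprimep_expl // coprimep_sym coprimepX rootE horner_prod.
  rewrite big_nat_cond big1 ?oner_eq0 // => k; rewrite andbT => /andP[k0 _].
  by rewrite mul1n !hornerE expr0n eqn0Ngt k0 subr0.
rewrite -(Gauss_dvdpr _ co).
pose D : {poly 'F_2} := \prod_(k < n.+1) (1 - 'X ^+ k.*2.+1).
pose N : {poly 'F_2} := qpochn 2 n.+1.
have [v Dpsi] : exists v, D * psi = N + v * 'X^(m.+1).
  rewrite /D /psi /triangular_poly triangular_sum big_ord_recl /=.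
  eexists; rewrite big_ord0 mul1r mul0n mulr1; congr (_ + _).
    by rewrite /N /qpochn big_add1; apply: eq_bigr => k _; rewrite mul2n.
  under eq_bigr do rewrite mulSn exprD mulrCA mulrC.
  by rewrite -big_distrl.
have [u N'] := qpochn_stable 'F_2 2 n.+1 n.+1.
rewrite addnn -/m -/N in N'.
have Qm : qpochn 1 m = D * N by exact: qpochn_double.
have Q2 : qpochn 1 m ^+ 2 = qpochn 2 m :> {poly 'F_2} by exact: qpochn_sqr.
(* Modulo X^(m+1), N (D psi) is N^2, and [qpochn 2 m] is N; the quotient comes from factoring the
   difference of squares. *)
apply/dvdpP; exists (N * v - u * 'X * (qpochn 2 m + N)).
transitivity (N * (D * psi) - qpochn 1 m ^+ 2 * qpochn 2 m).
  by rewrite Qm; ring.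
rewrite Q2 Dpsi N'.
have -> : (2 * n.+2 = m.+1.+1)%N by lia.
by rewrite (exprS _ m.+1); ring.
Qed.

(** Truncation at degree m does not affect coefficients up to m, so the power series identity passes
    to polynomials. *)
Lemma cubic_partitions_inv m i : (i <= m)%N ->
  ((\prod_(1 <= k < m.+1) (1 - 'X^(1 * k))) *
   (\prod_(1 <= k < m.+1) (1 - 'X^(2 * k))) *
   \poly_(k < m.+1) cubic_partitions k)`_i = (i == 0%N)%:R :> int.
Proof.
move=> le_im; rewrite -[RHS](cubic_partitions_gf i) coefM /fps_mul.
apply: eq_bigr => -[j /= le_ji] _; rewrite coef_poly coefM.
have lt_ij : (i - j < m.+1)%N by lia.
rewrite lt_ij; congr (_ * _); apply: eq_bigr => -[k /= le_kj] _.
by rewrite !qpoch_limit //; lia.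
Qed.

(** This is coefficient i of psi times the generating function. The bounds say T_k <= i < T_(k+1),
    so exactly the j <= k contribute. *)
Lemma cubic_triangular_recurrence k i : (0 < i)%N ->
  ('C(k.+1, 2) <= i <= 'C(k.+1, 2) + k)%N ->
  \sum_(j < k.+1) (cubic_partitions (i - 'C(j.+1, 2))%N)%:~R = 0 :> 'F_2.
Proof.
move=> i0 /andP[le_ki le_ik].
(* Large enough for degree 2n to reach i and for the truncated psi to contain all j <= k. *)
pose n := (i + k).+1.
have [u psiE] := dvdpP _ _ (pochhammer_triangular n isT).
have le_in : (i <= n.*2)%N by rewrite /n; lia.
have := cubic_partitions_inv _ _ le_in.
move/(congr1 (fun z : int => z%:~R : 'F_2)).
rewrite -coef_map !rmorphM /= !map_qpochn -[i == 0%N]negbK -lt0n i0 /=.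
set A := map_poly _ _.
have {psiE} -> : qpochn 1 n.*2 * qpochn 2 n.*2 =
    triangular_poly n.*2 - u * 'X^(n.*2.+1) by rewrite -psiE; ring.
rewrite mulrBl mulrAC coefB coefMXn ltnS le_in subr0.
rewrite /triangular_poly big_distrl coef_sum /= mulr0z => sum0.
have le_kn : (k.+1 <= n.*2)%N by rewrite /n; lia.
pose F j := ('X^('C(j.+1, 2)) * A)`_i.
rewrite -[RHS]sum0 -(big_mkord xpredT F) (big_cat_nat (leq0n _) le_kn) //= [X in _ + X]big1_seq.
  rewrite addr0 big_mkord; apply: eq_bigr => -[j /= le_jk] _.
  rewrite /F coefXnM coef_map coef_poly ltnNge.
  have -> : ('C(j.+1, 2) <= i)%N by apply: leq_trans le_ki; exact: leq_bin2l.
  by have -> : (i - 'C(j.+1, 2) < n.*2.+1)%N by lia.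
(* For j > k, T_j >= T_(k+1) = T_k + k + 1 > i. *)
move=> j; rewrite mem_index_iota /= => /andP[lt_kj _].
rewrite /F coefXnM; case: ifP => // /negbT; rewrite -leqNgt => le_ji.
have := leq_trans (@leq_bin2l k.+2 j.+1 2 lt_kj) le_ji.
by rewrite binS bin1; lia.
Qed.

Lemma infinite_nat_unbounded (P : nat -> Prop) :
  (forall n, exists2 m, (n < m)%N & P m) -> infinite_set [set n | P n]%classic.
Proof.
move=> Pinf /finite_seqP[s sP].
have [m lt_sm Pm] := Pinf (\max_(i <- s) i).
have : m \in s by have : [set` s]%classic m by rewrite -sP.
by move=> /(@leq_bigmax_seq _ s xpredT id)/(_ isT); rewrite leqNgt lt_sm.
Qed.

Lemma cubic_partitions0_odd : (cubic_partitions 0)%:~R = 1 :> 'F_2.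
Proof.
have := @cubic_partitions_inv 0 0 isT; rewrite !big_geq // !mul1r coef_poly /=.
by move=> ->.
Qed.

Lemma F2_neq0_eq1 (x : 'F_2) : x != 0 -> x = 1.
Proof. by case: x => -[|[|]] // ? _; apply/val_inj. Qed.

Theorem theorem1p6 :
  infinite_set [set n : nat | (2 %| cubic_partitions n)%Z]%classic /\
  infinite_set [set n : nat | ~~ (2 %| cubic_partitions n)%Z]%classic.
Proof.
have dvd2E z : (2 %| z)%Z = (z%:~R == 0 :> 'F_2).
  exact: (dvdz_pcharf (pchar_Fp _)).
have shift k : 'C(k.+2, 2) = ('C(k.+1, 2) + k.+1)%N by rewrite binS bin1.
have eventually_const (c : 'F_2) n :
    exists2 m, (n < m)%N & (cubic_partitions m)%:~R != c.
  apply: contrapT => noneP.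
  have {noneP} constP m : (n < m)%N -> (cubic_partitions m)%:~R = c.
    by move=> lt_nm; apply: contrapT => /eqP ne; apply: noneP; exists m.
  (* The arguments i - T_j with j <= k are at least k for i = T_k + k = T_(k+1) - 1, and at least k
     + 1 for i = T_(k+1), hence all exceed n. *)
  pose k := n.+1; have leT j : (j < k.+1)%N -> ('C(j.+1, 2) <= 'C(k.+1, 2))%N.
    by move=> lt_jk; apply: leq_bin2l.
  have Sc : \sum_(j < k.+1) c = 0.
    rewrite -[RHS](@cubic_triangular_recurrence k ('C(k.+1, 2) + k)); try lia.
    by apply: eq_bigr => j _; rewrite constP //; have := leT j (ltn_ord j); lia.
  have := @cubic_triangular_recurrence k.+1 ('C(k.+2, 2)).
  rewrite shift => H; have {H} := H ltac:(lia) ltac:(lia).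
  rewrite big_ord_recr /= shift subnn cubic_partitions0_odd.
  rewrite (eq_bigr (fun=> c)) ?Sc ?add0r => [/eqP|j _].
    by rewrite oner_eq0.
  by rewrite constP //; have := leT j (ltn_ord j); lia.
split; apply: infinite_nat_unbounded => n.
  have [m lt_nm /eqP ne1] := eventually_const 1 n; exists m => //.
  by rewrite dvd2E; apply: contrapT => /negP /F2_neq0_eq1.
by have [m lt_nm ne0] := eventually_const 0 n; exists m; rewrite ?dvd2E.
Qed.
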